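(* Let $A$ be a $d$-dimensional $k$-stochastic matrix of order $n$ and let $S\subseteq\{1,\ldots,d\}$ with $|S|=\ell$. If $k>\ell$, then the $S$-projection $P_S(A)$ is a $(d-\ell)$-dimensional $(k-\ell)$-stochastic matrix of order $n$. If $k\le\ell$, then $P_S(A)=n^{\ell-k+1}J_n^{d-\ell}$.
   Context: Let $I_n^d = \{1,\ldots,n\}^d$. A $d$-dimensional matrix $A$ of order $n$ is an array $(a_\alpha)_{\alpha\in I_n^d}$ of real numbers (a $0$-dimensional matrix is a single number). For $k\in\{0,\ldots,d\}$, a $k$-dimensional plane in $A$ is a submatrix obtained by fixing some $d-k$ components of the indices and letting the other $k$ components vary from $1$ to $n$. For $k\in\{0,\ldots,d\}$, $A$ is $k$-stochastic if all its entries are nonnegative and the sum of entries in each $k$-dimensional plane equals $1$. $J_n^d$ denotes the $d$-dimensional matrix of order $n$ all of whose entries equal $1/n$. For a $d$-dimensional matrix $A$ of order $n$ and $S\subseteq\{1,\ldots,d\}$, $|S|=\ell$, the $S$-projection $P_S(A)$ is the $(d-\ell)$-dimensional matrix of order $n$ whose entry at $\beta\in I_n^{d-\ell}$ is the sum of $a_\alpha$ over all $n^\ell$ indices $\alpha\in I_n^d$ whose components at the positions outside $S$ are, in order, the components of $\beta$ (the components at the positions in $S$ vary freely and independently from $1$ to $n$). *)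

(* Defs.v *)
From HB Require Import structures.
From mathcomp Require Import all_boot all_order all_algebra.
From mathcomp Require Import reals.

Set Implicit Arguments.
Unset Strict Implicit.
Unset Printing Implicit Defensive.

Import Order.TTheory GRing.Theory Num.Theory.
Local Open Scope ring_scope.

Notation multi_index d n := {ffun 'I_d -> 'I_n}.

(* The codomain is R^o, rather than R, so that arrays form an R-module and
   can be scaled with *: *)
Notation array R d n := {ffun multi_index d n -> R^o}.

(* Only the values of c at the positions outside F matter. *)
Definition plane (d n : nat) (F : {set 'I_d}) (c : multi_index d n) :
    {set multi_index d n} :=
  [set a : multi_index d n | [forall i, (i \notin F) ==> (a i == c i)]].

Definition stochastic (R : realType) (d n k : nat) (A : array R d n) : Prop :=
  [/\ (k <= d)%N,
      forall a : multi_index d n, 0 <= A a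
    & forall (F : {set 'I_d}) (c : multi_index d n), #|F| = k ->
        \sum_(a in plane F c) A a = 1].

Definition uniform_array (R : realType) (d n : nat) : array R d n :=
  [ffun=> 1 / n%:R].

Lemma card_outside (d : nat) (S : {set 'I_d}) : (d - #|S|)%N = #|~: S|.
Proof. by rewrite [RHS]cardsCs setCK card_ord. Qed.

(* The j-th position outside S: enum lists ordinals in increasing order. *)
Definition outside (d : nat) (S : {set 'I_d}) (j : 'I_(d - #|S|)) : 'I_d :=
  enum_val (cast_ord (card_outside S) j).

Definition projection (R : realType) (d n : nat) (S : {set 'I_d})
    (A : array R d n) : array R (d - #|S|) n :=
  [ffun b : multi_index (d - #|S|) n =>
     \sum_(a : multi_index d n | [forall j, a (outside j) == b j]) A a].

(* Main.v *)
Require Import Defs.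
From HB Require Import structures.
From mathcomp Require Import all_boot all_order all_algebra.
From mathcomp Require Import reals.

(** Summing a projection over a plane of the smaller array is summing the
    original array over a plane whose free positions are those of [S] together
    with the positions that were free in the small plane
    ([sum_projection_plane]); its dimension is therefore larger by exactly
    [#|S|].  Both claims follow by looking at the dimension of that plane.

    If [#|S| < k], a [k - #|S|]-dimensional plane of the projection corresponds
    to a [k]-dimensional plane of [A], whose sum is 1.

    If [k <= #|S|], a single entry of the projection, viewed as a
    0-dimensional plane, corresponds to an [#|S|]-dimensional plane of [A].
    Slicing along one free position at a time cuts it into [n ^ (#|S| - k)]
    planes of dimension [k] ([sum_plane_stochastic]), so every entry equals
    [n ^ (#|S| - k)], which is [n ^ (#|S| - k + 1)] times [1 / n]. *)

Set Implicit Arguments.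
Unset Strict Implicit.
Unset Printing Implicit Defensive.

Import Order.TTheory GRing.Theory Num.Theory.
Local Open Scope ring_scope.

Lemma planeP (d n : nat) (F : {set 'I_d}) (c a : multi_index d n) :
  reflect (forall i, i \notin F -> a i = c i) (a \in plane F c).
Proof.
rewrite inE; apply: (iffP forallP) => [ac i iF | ac i].
  by apply/eqP; apply: (implyP (ac i)).
by apply/implyP => iF; apply/eqP/ac.
Qed.

Lemma plane_set0 (d n : nat) (c : multi_index d n) : plane set0 c = [set c].
Proof.
apply/setP => a; rewrite in_set1; apply/planeP/eqP => [ac | -> //].
by apply/ffunP => i; apply: ac; rewrite inE.
Qed.

(** The parts of a plane on which the free position [i] takes a given value
    are planes in which [i] is fixed. *)
Lemma sum_plane_slice (V : nmodType) (d n : nat) (F : {set 'I_d}) (i : 'I_d)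
    (c : multi_index d n) (A : multi_index d n -> V) :
  i \in F ->
  \sum_(a in plane F c) A a =
    \sum_(v < n)
      \sum_(a in plane (F :\ i) [ffun j => if j == i then v else c j]) A a.
Proof.
move=> iF; rewrite (partition_big (fun a : multi_index d n => a i) xpredT) //=.
apply: eq_bigr => v _; apply: eq_bigl => a.
apply/andP/planeP => [[/planeP ac /eqP av] j | ac].
  by rewrite !inE negb_and negbK ffunE; case: eqVneq => [-> // | _ /ac].
split; last by rewrite ac ?ffunE ?eqxx // !inE eqxx.
apply/planeP => j jF; rewrite ac; last by rewrite !inE negb_and jF orbT.
by rewrite ffunE; case: eqVneq jF => // ->; rewrite iF.
Qed.

Lemma sum_plane_stochastic (R : realType) (d n k : nat) (A : array R d n)
    (F : {set 'I_d}) (c : multi_index d n) :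
  stochastic k A -> (k <= #|F|)%N ->
  \sum_(a in plane F c) A a = n%:R ^+ (#|F| - k).
Proof.
move=> [_ _ A1] /subnK cardF.
move: (#|F| - k)%N cardF => m; elim: m F c => [|m IHm] F c cardF.
  by rewrite expr0; apply: A1.
have /card_gt0P [i iF] : (0 < #|F|)%N by rewrite -cardF.
have cardFi : (m + k = #|F :\ i|)%N.
  by move: cardF; rewrite (cardsD1 i F) iF addSn add1n => -[].
rewrite (sum_plane_slice _ _ iF) (eq_bigr (fun=> n%:R ^+ m)) => [|v _].
  by rewrite sumr_const card_ord exprS mulr_natl.
exact: IHm.
Qed.

Lemma outside_inj (d : nat) (S : {set 'I_d}) : injective (@outside d S).
Proof. by move=> i j /enum_val_inj /cast_ord_inj. Qed.

Lemma outside_notin (d : nat) (S : {set 'I_d}) (j : 'I_(d - #|S|)) :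
  outside j \notin S.
Proof. by rewrite -in_setC; apply: enum_valP. Qed.

Lemma outside_onto (d : nat) (S : {set 'I_d}) (i : 'I_d) :
  i \notin S -> exists j, i = @outside d S j.
Proof.
rewrite -in_setC => iS.
exists (cast_ord (esym (card_outside S)) (enum_rank_in iS i)).
by rewrite /outside cast_ordKV enum_rankK_in.
Qed.

Lemma card_setU_outside (d : nat) (S : {set 'I_d})
    (F : {set 'I_(d - #|S|)}) :
  #|S :|: [set outside j | j in F]| = (#|S| + #|F|)%N.
Proof.
rewrite cardsU disjoint_setI0 ?cards0 ?subn0.
  by rewrite card_imset //; apply: outside_inj.
rewrite disjoint_sym disjoint_subset; apply/subsetP => _ /imsetP [j _ ->].
exact: outside_notin.
Qed.

(** The positions in [S] receive an arbitrary value, whence the need for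
    [0 < n]. *)
Lemma extend_multi_index (d n : nat) (S : {set 'I_d})
    (b : multi_index (d - #|S|) n) :
  (0 < n)%N -> exists c : multi_index d n, forall j, c (outside j) = b j.
Proof.
move=> n_gt0.
exists [ffun i => if [pick j | outside j == i] is Some j then b j
                  else Ordinal n_gt0] => j.
rewrite ffunE; case: pickP => [j' /eqP /outside_inj -> // | /(_ j)].
by rewrite eqxx.
Qed.

(** The fibres over which the projection sums partition the indices of [A];
    those lying over a plane of the projection make up the plane of [A] in
    which the positions of [S] are free as well. *)
Lemma sum_projection_plane (R : realType) (d n : nat) (S : {set 'I_d})
    (A : array R d n) (F : {set 'I_(d - #|S|)})
    (b : multi_index (d - #|S|) n) (c : multi_index d n) :
  (forall j, c (outside j) = b j) ->
  \sum_(b' in plane F b) projection S A b' =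
    \sum_(a in plane (S :|: [set outside j | j in F]) c) A a.
Proof.
move=> cb.
pose restrict (a : multi_index d n) : multi_index (d - #|S|) n :=
  [ffun j => a (outside j)].
have restrictE (a : multi_index d n) (b' : multi_index (d - #|S|) n) :
    [forall j : 'I_(d - #|S|), a (outside j) == b' j] = (restrict a == b').
  apply/forallP/eqP => [ab | <- j]; last by rewrite ffunE.
  by apply/ffunP => j; rewrite ffunE; apply/eqP.
have restrict_plane a : (a \in plane (S :|: [set outside j | j in F]) c) =
                        (restrict a \in plane F b).
  apply/planeP/planeP => ac i.
    rewrite ffunE -cb => iF; apply: ac.
    by rewrite inE negb_or outside_notin mem_imset //; apply: outside_inj.
  rewrite inE negb_or => /andP [/outside_onto [j ->]].
  rewrite mem_imset; last exact: outside_inj.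
  by move=> /ac; rewrite ffunE cb.
rewrite [RHS](partition_big restrict (mem (plane F b))) /=; last first.
  by move=> a; rewrite restrict_plane.
apply: eq_bigr => b' b'F; rewrite ffunE; apply: eq_bigl => a.
rewrite restrictE restrict_plane.
by case: eqP => [-> | _]; rewrite ?b'F ?andbF.
Qed.

Theorem theorem4 (R : realType) (d n k : nat) (n_gt0 : (0 < n)%N)
    (A : array R d n) (A_stochastic : stochastic k A) (S : {set 'I_d}) :
  ((#|S| < k)%N -> stochastic (k - #|S|) (projection S A)) /\
  ((k <= #|S|)%N ->
     projection S A =
       n%:R ^+ (#|S| - k + 1) *: uniform_array R (d - #|S|) n).
Proof.
split=> [ltSk | lekS].
  case: (A_stochastic) => [lekd A_ge0 A1]; split.
  - exact: leq_sub2r.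
  - by move=> b; rewrite ffunE; apply: sumr_ge0.
  - move=> F b cardF; have [c cb] := extend_multi_index b n_gt0.
    rewrite (sum_projection_plane _ _ cb); apply: A1.
    by rewrite card_setU_outside cardF subnKC // ltnW.
apply/ffunP => b; have [c cb] := extend_multi_index b n_gt0.
have := sum_projection_plane A set0 cb.
rewrite plane_set0 big_set1 imset0 setU0 => ->.
rewrite (sum_plane_stochastic c A_stochastic lekS) !ffunE /GRing.scale /=.
by rewrite mul1r addn1 exprSr mulfK // pnatr_eq0 -lt0n.
Qed.
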